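(* Let $(L,d_h)$ be a geometric modular lattice with height function $h$ and $h(I)=n$, where $I$ is the greatest element of $L$ and $d_h$ is the metric induced by the height function. Let $C$ be a scheme of $L$ with minimum distance $d$. Then $$|C|\le |L'|,$$ where $L'=[O,w]$ for an element $w\in L$ and $h(w)=n-\alpha_L$. The constant $\alpha_L$ depends on the lattice as follows: 1. $\alpha_L=d-1$, when $L$ is distributive; 2. $\alpha_L=\left\lfloor \frac{d-2}{2}\right\rfloor$, when $L$ is modular.
   Context: All lattices are finite, with a unique greatest element $I$ and a unique least element $O$; join and meet are written $\vee$ and $\wedge$. The height $h(x)$ of $x\in L$ is the maximum length $l$ of a chain $O=x_0<x_1<\cdots<x_l=x$. A lattice is modular if $a\le c$ implies $a\vee(b\wedge c)=(a\vee b)\wedge c$; it is distributive if $a\vee(b\wedge c)=(a\vee b)\wedge(a\vee c)$ and $a\wedge(b\vee c)=(a\wedge b)\vee(a\wedge c)$ for all $a,b,c$. A geometric modular lattice is a modular lattice of finite height in which every element is a join of atoms (elements of height 1). In a modular lattice of finite length, $d_h(a,b):=h(a\vee b)-h(a\wedge b)$ is a metric. A (lattice) scheme in $(L,d_h)$ is a subset $C\subseteq L$; its minimum distance is $d=\min\{d_h(a,b): a,b\in C,\ a\ne b\}$. The interval $[O,w]$ is $\{x\in L: O\le x\le w\}$. *)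

(* Defs.v *)
From mathcomp Require Import all_boot all_order all_algebra.
Set Implicit Arguments.
Unset Strict Implicit.
Unset Printing Implicit Defensive.
Import Order.TTheory.

Local Open Scope order_scope.

Definition modular_lattice disp (L : latticeType disp) : Prop :=
  forall a b c : L, a <= c -> a `|` (b `&` c) = (a `|` b) `&` c.

Definition distributive_lattice disp (L : latticeType disp) : Prop :=
  (forall a b c : L, a `|` (b `&` c) = (a `|` b) `&` (a `|` c)) /\
  (forall a b c : L, a `&` (b `|` c) = (a `&` b) `|` (a `&` c)).

(* A chain \bot = x_0 < x_1 < ... < x_l = x is the tuple s of its l upper
   elements. Its l + 1 elements are distinct, so the range l < #|L| is no
   restriction. *)
Definition height disp (L : finTBLatticeType disp) (x : L) : nat :=
  (\max_(l < #|L| | [exists s : l.-tuple L,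
                       path <%O \bot s && (last \bot s == x)]) l)%N.

Definition atom disp (L : finTBLatticeType disp) (a : L) : bool :=
  height a == 1%N.

(* The empty join is \bot; finiteness of the height is automatic here, since L
   is finite. *)
Definition geometric_modular disp (L : finTBLatticeType disp) : Prop :=
  modular_lattice L /\
  forall x : L, exists A : {set L},
    {in A, forall a, atom a} /\ x = \join_(a in A) a.

(* height is monotone, so the subtraction of naturals is exact. *)
Definition height_dist disp (L : finTBLatticeType disp) (a b : L) : nat :=
  (height (a `|` b) - height (a `&` b))%N.

(* d = min {height_dist a b | a, b in C, a != b}; in particular C must have at
   least two elements. *)
Definition has_min_dist disp (L : finTBLatticeType disp) (C : {set L})
    (d : nat) : Prop :=
  (exists a b : L, [/\ a \in C, b \in C, a != b & height_dist a b = d]) /\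
  (forall a b : L, a \in C -> b \in C -> a != b -> (d <= height_dist a b)%N).

Definition lower_interval disp (L : finTBLatticeType disp) (w : L) : {set L} :=
  [set x | \bot <= x <= w].

(* The bound holds whichever element w of height n - alpha is chosen, and such
   an element exists. The guard 0 <= alpha only matters for
   alpha = floor ((d - 2) / 2) with d = 1, where n - alpha = n + 1 is not a
   height. *)
Definition interval_bound disp (L : finTBLatticeType disp) (C : {set L})
    (n : nat) (alpha : int) : Prop :=
  ((0 <= alpha)%R -> exists w : L, ((height w)%:Z = n%:Z - alpha)%R) /\
  (forall w : L, ((height w)%:Z = n%:Z - alpha)%R ->
     (#|C| <= #|lower_interval w|)%N).

(* Main.v *)
(** In a finite modular lattice the height is modular,
    h(a \/ b) + h(a /\ b) = h(a) + h(b).  If h(w) = n - alpha, this shows that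
    a |-> a /\ w lowers the height of any a by at most alpha, since
    h(a) - h(a /\ w) = h(a \/ w) - h(w).  Hence a /\ w = b /\ w forces
    d_h(a, b) <= 2 alpha; when L is distributive, a \/ b and a /\ b also have the
    same meet with w, and d_h(a, b) <= alpha.  In both cases this is less than
    d, so a |-> a /\ w is injective from C to [O, w]. *)
Require Import Defs.
From mathcomp Require Import all_boot all_order all_algebra.
From mathcomp Require Import zify.
Import Order.TTheory.
Set Implicit Arguments.
Unset Strict Implicit.
Unset Printing Implicit Defensive.

Section Height.
Context {disp : Order.disp_t} {L : finTBLatticeType disp}.
Implicit Types (x y z a b c w : L) (s : seq L).
Local Open Scope order_scope.

Lemma path_size_height s :
  path <%O \bot s -> (size s <= height (last \bot s))%N.
Proof.
move=> s_path.
(* The maximum defining [height] only ranges over lengths below [#|L|], so the chain must first be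
   seen to have distinct entries. *)
have size_lt : (size s < #|L|)%N.
  have s_uniq : uniq (\bot :: s).
    by apply: (sorted_uniq (@lt_trans _ L) (@ltxx _ L)).
  by have := max_card [in (\bot : L) :: s]; rewrite (card_uniqP s_uniq).
apply: (bigop.bigmax_sup (Ordinal size_lt)) => //=.
by apply/existsP; exists (in_tuple s); rewrite s_path eqxx.
Qed.

Lemma heightP x :
  exists s, [/\ path <%O \bot s, last \bot s = x & size s = height x].
Proof.
pose P (l : 'I_#|L|) :=
  [exists s : l.-tuple L, path <%O \bot s && (last \bot s == x)].
(* A maximum is attained only over a nonempty index set: the empty chain serves for [\bot], the
   one-step chain otherwise. *)
have card_gt0 : (0 < #|P|)%N.
  apply/card_gt0P.
  have [xE|x_neq0] := eqVneq x \bot.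
    have lt0 : (0 < #|L|)%N by apply/card_gt0P; exists x.
    exists (Ordinal lt0); apply/existsP; exists [tuple].
    by rewrite /= xE eqxx.
  have lt1 : (1 < #|L|)%N.
    by apply/card_gt1P; exists x, \bot; split.
  exists (Ordinal lt1); apply/existsP; exists [tuple x].
  by rewrite /= lt0x x_neq0 eqxx.
have [l /existsP[s /andP[s_path /eqP s_last]] lE] :=
  eq_bigmax_cond (fun l : 'I_#|L| => l : nat) card_gt0.
by exists s; rewrite size_tuple; split.
Qed.

Lemma height_lt x y : x < y -> (height x < height y)%N.
Proof.
have [s [s_path s_last <-]] := heightP x => ltxy.
have := @path_size_height (rcons s y).
by rewrite rcons_path s_path s_last last_rcons size_rcons; apply.
Qed.

Lemma height_le x y : x <= y -> (height x <= height y)%N.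
Proof. by rewrite le_eqVlt => /predU1P[->|/height_lt/ltnW]. Qed.

Lemma height_le_top x : (height x <= height (\top : L))%N.
Proof. exact: height_le (lex1 x). Qed.

Lemma height_pred x :
  (0 < height x)%N -> exists2 z, z < x & height x = (height z).+1.
Proof.
have [s [s_path s_last sizeE]] := heightP x.
rewrite -sizeE; case/lastP: s => // s y in s_path s_last sizeE * => _.
move: s_path s_last sizeE; rewrite rcons_path last_rcons size_rcons.
move=> /andP[s_path lt_sy] yx sizeE; rewrite yx in lt_sy.
exists (last \bot s) => //; apply/eqP; rewrite eqSS eqn_leq.
by rewrite path_size_height //= -ltnS sizeE height_lt.
Qed.

Lemma height_surj x k : (k <= height x)%N -> exists w, height w = k.
Proof.
have [m] := ubnP (height x); elim: m x => // m IHm x ltxm.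
rewrite leq_eqVlt => /predU1P[->|ltkx]; first by exists x.
have [|z _ hxE] := @height_pred x; first exact: leq_trans ltkx.
by apply: (IHm z); lia.
Qed.

Definition covered x y : Prop :=
  x < y /\ forall z, x <= z -> z <= y -> z = x \/ z = y.

Lemma height_succ_covered x y :
  x < y -> height y = (height x).+1 -> covered x y.
Proof.
move=> ltxy hyE; split=> // z.
rewrite le_eqVlt => /predU1P[->|/height_lt ltxz]; first by left.
by rewrite le_eqVlt => /predU1P[->|/height_lt ltzy]; [right | lia].
Qed.

Lemma exists_lower_cover a e : e < a -> exists2 c, e <= c & covered c a.
Proof.
move=> ltea.
case: (@arg_maxnP _ e (fun c => e <= c < a) (@height _ L)).
  by rewrite lexx.
move=> c /andP[lec ltca] cmax; exists c => //; split=> // z.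
rewrite le_eqVlt => /predU1P[->|ltcz]; first by left.
rewrite le_eqVlt => /predU1P[->|ltza]; first by right.
have := cmax z; rewrite (le_trans lec (ltW ltcz)) ltza => /(_ isT) /=.
by rewrite leqNgt (height_lt ltcz).
Qed.

Hypothesis modL : modular_lattice L.

(** By modularity, [z] in the interval from [q] to [p \/ q] is recovered from [p /\ z] as
    [q \/ (p /\ z)]; the cover leaves two values for [p /\ z]. *)
Lemma covered_join p q : covered (p `&` q) p -> covered q (p `|` q).
Proof.
case=> lt_meet covp; split.
  rewrite lt_neqAle leUr andbT; apply: contraTN lt_meet => /eqP qE.
  by rewrite [p `&` q](meet_idPl _) ?ltxx // qE leUl.
move=> z leqz lezpq.
have zE : q `|` (p `&` z) = z.
  by rewrite modL // joinC; apply/meet_idPr.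
have [||pz|pz] := covp (p `&` z).
- by rewrite leI2.
- exact: leIl.
- by left; rewrite -zE pz; apply/join_idPl; exact: leIr.
- by right; rewrite -zE pz joinC.
Qed.

(** Dually, [z] is recovered from [z \/ q] as [(z \/ q) /\ p]. *)
Lemma covered_meet p q : covered q (p `|` q) -> covered (p `&` q) p.
Proof.
case=> lt_join covq; split.
  rewrite lt_neqAle leIl andbT; apply: contraTN lt_join => /eqP pE.
  by rewrite [p `|` q](join_idPr _) ?ltxx // -pE leIr.
move=> z lepqz lezp.
have zE : (z `|` q) `&` p = z.
  by rewrite -modL // meetC; apply/join_idPl.
have [||zq|zq] := covq (z `|` q).
- exact: leUr.
- by rewrite leU2.
- by left; rewrite -zE zq meetC.
- by right; rewrite -zE zq; apply/meet_idPr; exact: leUl.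
Qed.

(** Jordan-Dedekind property, by induction on [height y]. Let [z] precede [y] on a longest chain. If
    [z] differs from [x], both are covered by [y = z \/ x], hence both cover [z /\ x] and have equal
    height by induction. *)
Lemma covered_height x y : covered x y -> height y = (height x).+1.
Proof.
have [m] := ubnP (height y); elim: m x y => // m IHm x y ltym [ltxy covxy].
have [|z ltzy hyE] := @height_pred y.
  exact: leq_ltn_trans (height_lt ltxy).
have [<-//|neqzx] := eqVneq z x.
have covzy : covered z y by exact: height_succ_covered.
have joinE : z `|` x = y.
  have [||joinx|//] := covxy (z `|` x); first exact: leUr.
    by rewrite leUx !ltW.
  have lezx : z <= x by rewrite -joinx leUl.
  have [xz|xy] := covzy.2 x lezx (ltW ltxy).
    by rewrite xz eqxx in neqzx.
  by rewrite xy ltxx in ltxy.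
have hz : height z = (height (z `&` x)).+1.
  apply: IHm; first by lia.
  by apply: covered_meet; rewrite joinE.
have hx : height x = (height (z `&` x)).+1.
  apply: IHm; first by have := height_lt ltxy; lia.
  by rewrite meetC; apply: covered_meet; rewrite joinC joinE.
by rewrite hyE hz hx.
Qed.

(** Induction on [height a]: passing from [a] to a lower cover [c] above [a /\ b] keeps the meet
    with [b] and lowers the heights of [a] and [a \/ b] by one each. *)
Lemma height_modular a b :
  (height (a `|` b) + height (a `&` b) = height a + height b)%N.
Proof.
have [m] := ubnP (height a); elim: m a => // m IHm a ltam.
have := leIl a b; rewrite le_eqVlt => /predU1P[meetE|lt_meet].
  by rewrite meetE (join_idPr _) 1?addnC // -meetE leIr.
have [c lec covca] := exists_lower_cover lt_meet.
have leca : c <= a := ltW covca.1.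
have cbE : c `&` b = a `&` b.
  by apply/le_anti; rewrite leI2 //= lexI lec leIr.
have meetE : a `&` (c `|` b) = c.
  by rewrite meetC -modL // [b `&` a]meetC; apply/join_idPl.
have joinE : a `|` (c `|` b) = a `|` b by rewrite joinA (join_idPl leca).
have hab : height (a `|` b) = (height (c `|` b)).+1.
  apply: covered_height; rewrite -joinE; apply: covered_join.
  by rewrite meetE.
have ha := covered_height covca.
by have := IHm c; rewrite cbE; lia.
Qed.

Lemma height_distE a b :
  (height_dist a b + 2 * height (a `&` b) = height a + height b)%N.
Proof.
have := height_modular a b.
have : (height (a `&` b) <= height (a `|` b))%N.
  by apply: height_le; apply: le_trans (leIl _ _) (leUl _ _).
by rewrite /height_dist; lia.
Qed.

Lemma height_dist_meet_eq a b w : a `&` w = b `&` w ->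
  (height_dist a b + 2 * height w <= 2 * height (\top : L))%N.
Proof.
move=> awbw.
(* The common meet with [w] lies below both [a] and [b]. *)
have hmeet : (height (a `&` w) <= height (a `&` b))%N.
  by apply: height_le; rewrite lexI leIl awbw leIl.
have := height_le_top (a `|` w); have := height_le_top (b `|` w).
have := height_modular a w; have := height_modular b w.
have := height_distE a b; rewrite -awbw; lia.
Qed.

Lemma height_dist_meet_eq_distributive a b w :
  distributive_lattice L -> a `&` w = b `&` w ->
  (height_dist a b + height w <= height (\top : L))%N.
Proof.
move=> [_ meetUr] awbw.
have uwE : (a `|` b) `&` w = a `&` w.
  by rewrite meetC meetUr ![w `&` _]meetC awbw joinxx.
have vwE : (a `&` b) `&` w = a `&` w.
  by rewrite -meetA -awbw meetA meetxx.
(* As the meets with [w] agree, the distance equals the height of [(a \/ b) \/ w] minus that of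
   [(a /\ b) \/ w], and both heights lie between those of [w] and [\top]. *)
have := height_le_top w; have := height_le_top ((a `|` b) `|` w).
have := height_le (leUr w (a `&` b)).
have := height_modular (a `|` b) w; have := height_modular (a `&` b) w.
by rewrite uwE vwE /height_dist; lia.
Qed.

End Height.

Section Bound.
Context {disp : Order.disp_t} {L : finTBLatticeType disp}.
Implicit Types (a b w : L) (C : {set L}).
Local Open Scope order_scope.

(** Ensures that [n - alpha] is not negative, so that it is the height of some element. *)
Lemma min_dist_le_height C d :
  has_min_dist C d -> (d <= height (\top : L))%N.
Proof.
case=> [[a [b [_ _ _ <-]]] _].
exact: leq_trans (leq_subr _ _) (height_le_top _).
Qed.

Lemma card_le_lower_interval C d w : has_min_dist C d ->
  (forall a b, a `&` w = b `&` w -> (height_dist a b < d)%N) ->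
  (#|C| <= #|lower_interval w|)%N.
Proof.
move=> [_ dmin] dist_lt.
rewrite -(@card_in_imset _ _ (fun a => a `&` w) (mem C)).
  by apply/subset_leq_card/subsetP=> _ /imsetP[a _ ->]; rewrite inE le0x leIr.
move=> a b aC bC /dist_lt; apply: contraTeq => neqab.
by rewrite -leqNgt dmin.
Qed.

End Bound.

Theorem theorem6 (disp : Order.disp_t) (L : finTBLatticeType disp)
    (n d : nat) (C : {set L})
    (geomL : geometric_modular L)
    (height_top : height (\top%O : L) = n)
    (min_dist_C : has_min_dist C d) :
  (distributive_lattice L -> interval_bound C n (d%:Z - 1)%R) /\
  (modular_lattice L -> interval_bound C n ((d%:Z - 2)%R %/ 2)%Z).
Proof.
have modL := geomL.1.
have := min_dist_le_height min_dist_C; rewrite height_top => le_dn.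
split=> [distrL|_]; split=> [alpha_ge0|w hw].
- have [|w hw] := @height_surj _ L \top%O (n - (d - 1)).
    by rewrite height_top leq_subr.
  by exists w; rewrite hw; lia.
- apply: (card_le_lower_interval min_dist_C) => a b.
  move=> /(height_dist_meet_eq_distributive modL distrL).
  by have := height_le_top w; rewrite height_top; lia.
(* Here [alpha_ge0] forces [d >= 2], so the truncated [d - 2] agrees with the integer one. *)
- have [|w hw] := @height_surj _ L \top%O (n - (d - 2) %/ 2).
    by rewrite height_top leq_subr.
  by exists w; rewrite hw; lia.
(* The distance is at most twice [alpha], hence at most [d - 2]. If [d < 2], then [alpha = -1] and
   [w] would be higher than [\top]. *)
- apply: (card_le_lower_interval min_dist_C) => a b.
  move=> /(height_dist_meet_eq modL).
  by have := height_le_top w; rewrite height_top; lia.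
Qed.
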